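(* Let $p\le n$ be positive integers, let $X\in\mathrm{Sp}(2p,2n)$ and $Z\in\mathrm{T}_X\mathrm{Sp}(2p,2n)$. Let $Y(t)$ be a curve on $\mathrm{Sp}(2p,2n)$ satisfying the quasi-geodesic equation $$\ddot Y-YJ_{2p}(\dot Y^\top J_{2n}\dot Y)=0$$ with the initial conditions $Y(0)=X$ and $\dot Y(0)=Z$. Then $$Y(t)=[X,\ Z]\,\exp\left(t\begin{bmatrix} -J_{2p}W & J_{2p}Z^\top J_{2n}Z \\ I_{2p} & -J_{2p}W \end{bmatrix}\right)\begin{bmatrix} I_{2p} \\ 0 \end{bmatrix}e^{J_{2p}Wt},$$ where $W=X^\top J_{2n}Z$.
   Context: For a positive integer $m$, $J_{2m}=\begin{bmatrix} 0 & I_m \\ -I_m & 0 \end{bmatrix}$. The symplectic Stiefel manifold is $\mathrm{Sp}(2p,2n)=\{X\in\mathbb{R}^{2n\times 2p}: X^\top J_{2n}X=J_{2p}\}$, an embedded submanifold of $\mathbb{R}^{2n\times 2p}$, with tangent space $\mathrm{T}_X\mathrm{Sp}(2p,2n)=\{Z\in\mathbb{R}^{2n\times 2p}: Z^\top J_{2n}X+X^\top J_{2n}Z=0\}$ at $X$. Dots denote ordinary (Euclidean) derivatives in $t$ in $\mathbb{R}^{2n\times 2p}$; $\exp(A)$ and $e^A$ denote the matrix exponential. *)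

(* Defs.v *)
From HB Require Import structures.
From mathcomp Require Export all_boot all_order all_algebra.
From mathcomp Require Export all_classical all_reals all_analysis.

Set Implicit Arguments.
Unset Strict Implicit.
Unset Printing Implicit Defensive.

Import Order.TTheory GRing.Theory Num.Theory.
Import numFieldNormedType.Exports.

Local Open Scope ring_scope.
Local Open Scope classical_set_scope.

(* Even dimensions 2m are written m + m throughout, so that block matrices
   need no casts. *)

Definition J (R : realType) (m : nat) : 'M[R]_(m + m) :=
  block_mx 0 1%:M (- 1%:M) 0.

Definition symplectic_stiefel (R : realType) (p n : nat) :
    set 'M[R]_(n + n, p + p) :=
  [set X | X^T *m J R n *m X = J R p].

Definition tangent_symplectic_stiefel (R : realType) (p n : nat)
    (X : 'M[R]_(n + n, p + p)) : set 'M[R]_(n + n, p + p) :=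
  [set Z | Z^T *m J R n *m X + X^T *m J R n *m Z = 0].

(* The limit is taken in the norm topology of 'M[R]_m, where the series
   always converges, so the default value of lim is never used. *)
Definition expmx (R : realType) (m : nat) (A : 'M[R]_m) : 'M[R]_m :=
  limn (series (fun k : nat => (k`!%:R)^-1 *: A ^+ k)).

(* Y need only be twice differentiable; its values outside I are irrelevant
   when I is open, since derivatives are local. *)
Definition quasi_geodesic (R : realType) (p n : nat) (I : set R)
    (Y : R -> 'M[R]_(n + n, p + p)) : Prop :=
  forall t : R, I t ->
    [/\ symplectic_stiefel (Y t), derivable Y t 1, derivable (derive1 Y) t 1
      & derive1n 2 Y t - Y t *m J R p *m ((derive1 Y t)^T *m J R n *m derive1 Y t)
        = 0].

(* Main.v *)
Require Import Defs.
Set Implicit Arguments.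
Unset Strict Implicit.
Unset Printing Implicit Defensive.
Import Order.TTheory GRing.Theory Num.Theory.
Import numFieldNormedType.Exports.
Local Open Scope ring_scope.
Local Open Scope classical_set_scope.

(** Put A(t) = J W(t) with W(t) = Y^T J Y', and S(t) = Y'^T J Y'.  Differentiating
    Y^T J Y = J gives Y'^T J Y = - W, and then the equation Y'' = Y J S together
    with J J = - 1 gives two facts (lemmas [is_derive_W] and [is_derive_JS]):
    W' = S + J J S = 0, so A is constant along the curve; and
    (J S)' = (J S) A - A (J S), a Lax equation with constant A, whose solutions
    are the conjugates of the initial value, J S(t) = exp(- t A) J S(0) exp(t A)
    ([lax_conj]).

    Hence the equation becomes linear with constant coefficients in the moving
    frame P = [Y exp(- t A), Y' exp(- t A)]: the factor J S(t) exp(- t A) in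
    Y'' exp(- t A) can be replaced by exp(- t A) J S(0), so that P' = P B with
    B = [[- A, J S(0)], [1, - A]].  Therefore P(t) = P(0) exp(t B), and the first
    block column of this identity, multiplied by exp(t A), is the stated formula.

    No uniqueness theorem for differential equations is called upon: each linear
    equation is solved by checking that the solution multiplied by the inverse
    exponential has zero derivative, hence is constant on the interval
    ([is_derive0_cst]).  The derivative of the matrix exponential itself comes
    from termwise differentiation of the power series of its entries
    ([is_derive_expmx]). *)

(** * Limits and derivatives of matrix-valued functions *)

Lemma cvg_mxP (R : realType) (m n : nat) (T : Type) (F : set_system T)
    {FF : Filter F} (f : T -> 'M[R]_(m, n)) (M : 'M[R]_(m, n)) :
  f @ F --> M <-> forall i j, (fun x => f x i j) @ F --> M i j.
Proof.
split=> [fM i j|fM].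
  exact: (@cvg_comp _ _ _ f (fun N : 'M[R]_(m, n) => N i j) _ _ _ fM
    (@coord_continuous R m n i j M)).
apply/cvgrPdist_le => e e0.
near=> x.
rewrite /Num.Def.normr/= mx_normrE (bigmax_le _ (ltW e0))//= => i _.
rewrite !mxE/=.
move: i; near: x; apply: filter_forall => /= i.
exact: ((cvgrPdist_le _ _).1 (fM i.1 i.2)).
Unshelve. all: by end_near. Qed.

Lemma cvg_mulmx (R : realType) (m n q : nat) (T : Type) (F : set_system T)
    {FF : Filter F} (f : T -> 'M[R]_(m, n)) (g : T -> 'M[R]_(n, q))
    (M : 'M[R]_(m, n)) (N : 'M[R]_(n, q)) :
  f @ F --> M -> g @ F --> N -> (fun x => f x *m g x) @ F --> M *m N.
Proof.
move=> /cvg_mxP fM /cvg_mxP gN; apply/cvg_mxP => i j.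
rewrite mxE.
under eq_fun do rewrite mxE.
by apply: (cvg_big (@add_continuous R)) => k _; exact: cvgM.
Qed.

Lemma is_derive_mxP (R : realType) (m n : nat) (F : R -> 'M[R]_(m, n)) (t : R)
    (D : 'M[R]_(m, n)) :
  is_derive t 1 F D <-> forall i j, is_derive t 1 (fun x => F x i j) (D i j).
Proof.
split=> [[dF <-] i j|dF].
  apply: DeriveDef; first by move/derivable_mxP: dF.
  by rewrite derive_mx // mxE.
have dFt : derivable F t 1.
  by apply/derivable_mxP => i j; exact: (@ex_derive _ _ _ _ _ _ _ (dF i j)).
apply: DeriveDef => //.
rewrite derive_mx //; apply/matrixP => i j; rewrite mxE.
exact: (@derive_val _ _ _ _ _ _ _ (dF i j)).
Qed.

Lemma is_derive_mulmx (R : realType) (m n q : nat) (F : R -> 'M[R]_(m, n))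
    (G : R -> 'M[R]_(n, q)) (t : R) (dF : 'M[R]_(m, n)) (dG : 'M[R]_(n, q)) :
  is_derive t 1 F dF -> is_derive t 1 G dG ->
  is_derive t 1 (fun x => F x *m G x) (dF *m G t + F t *m dG).
Proof.
move=> /is_derive_mxP hF /is_derive_mxP hG; apply/is_derive_mxP => i j.
have -> : (fun x => (F x *m G x) i j)
    = \sum_k ((fun x => F x i k) * (fun x => G x k j)).
  by apply/funext => x; rewrite mxE fct_sumE.
apply: is_derive_eq.
rewrite !mxE -big_split /=; apply: eq_bigr => k _.
by rewrite addrC [dF i k * _]mulrC.
Qed.

Lemma is_derive_trmx (R : realType) (m n : nat) (F : R -> 'M[R]_(m, n)) (t : R)
    (dF : 'M[R]_(m, n)) :
  is_derive t 1 F dF -> is_derive t 1 (fun x => (F x)^T) dF^T.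
Proof.
move=> /is_derive_mxP hF; apply/is_derive_mxP => i j; rewrite mxE.
by under eq_fun do rewrite mxE; exact: hF.
Qed.

Lemma is_derive_row_mx (R : realType) (m n q : nat) (F : R -> 'M[R]_(m, n))
    (G : R -> 'M[R]_(m, q)) (t : R) (dF : 'M[R]_(m, n)) (dG : 'M[R]_(m, q)) :
  is_derive t 1 F dF -> is_derive t 1 G dG ->
  is_derive t 1 (fun x => row_mx (F x) (G x)) (row_mx dF dG).
Proof.
move=> /is_derive_mxP hF /is_derive_mxP hG; apply/is_derive_mxP => i j.
rewrite mxE; under eq_fun do rewrite mxE.
by case: (fintype.split j) => k; [exact: hF|exact: hG].
Qed.

(** The mean value theorem, applied entry by entry. *)
Lemma is_derive0_cst (R : realType) (m n : nat) (I : set R)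
    (F : R -> 'M[R]_(m, n)) :
  is_interval I -> (forall t, I t -> is_derive t 1 F 0) ->
  forall s t, I s -> I t -> F s = F t.
Proof.
move=> Iitv dF.
suff le_cst s t : I s -> I t -> s <= t -> F s = F t.
  by move=> s t Is It; case: (leP s t) => [/le_cst->//|/ltW/le_cst->].
move=> Is It le_st; apply/matrixP => i j; apply/eqP.
have dFij x : x \in `[s, t]%R -> is_derive x 1 (fun y => F y i j) 0.
  rewrite in_itv /= => st; have Ix : I x by exact: Iitv st.
  by have /is_derive_mxP/(_ i j) := dF x Ix; rewrite mxE.
rewrite eq_sym -subr_eq0; apply/eqP.
have cont : {within `[s, t], continuous (fun y => F y i j)}.
  apply: derivable_within_continuous => x /dFij dx.
  exact: (@ex_derive _ _ _ _ _ _ _ dx).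
have dFoo x : x \in `]s, t[%R -> is_derive x 1 (fun y => F y i j) 0.
  by move=> xst; apply: dFij; exact: subset_itv_oo_cc.
have [c _] := MVT_segment le_st dFoo cont.
by rewrite mul0r.
Qed.

(** * The matrix exponential *)

Local Notation exp_series A := (series (fun k : nat => (k`!%:R)^-1 *: A ^+ k)).

(** A geometric bound on the entries of B A^k; it lets the scalar exponential
    series dominate every series below. *)
Lemma mulmx_exp_entry_le (R : realType) (m : nat) (A B : 'M[R]_m) k i j :
  `|(B *m A ^+ k) i j| <= `|B| * (m%:R * `|A|) ^+ k.
Proof.
have entry_le (C : 'M[R]_m) i' j' : `|C i' j'| <= `|C|.
  by rewrite [leRHS]/Num.Def.normr/= mx_normrE; exact: (le_bigmax _ _ (i', j')).
elim: k i j => [|k IHk] i j; first by rewrite expr0 mulmx1 expr0 mulr1.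
rewrite exprSr -[A ^+ k * A]/(A ^+ k *m A) mulmxA mxE.
apply: le_trans (ler_norm_sum _ _ _) _.
apply: le_trans (_ : \sum_(l < m) (`|B| * (m%:R * `|A|) ^+ k * `|A|) <= _).
  by apply: ler_sum => l _; rewrite normrM ler_pM.
by rewrite sumr_const card_ord exprSr mulrA -[leLHS]mulr_natl mulrCA.
Qed.

(** The entries of B exp(x A) are power series in x with these coefficients.
    The factor B makes the family stable under termwise differentiation, which
    only replaces B by B A. *)
Definition expmx_coeff (R : realType) (m : nat) (A B : 'M[R]_m) (i j : 'I_m) :
  R^nat := fun k => (k`!%:R)^-1 * (B *m A ^+ k) i j.

Lemma pseries_diffs_expmx_coeff (R : realType) (m : nat) (A B : 'M[R]_m) i j :
  pseries_diffs (expmx_coeff A B i j) = expmx_coeff A (B *m A) i j.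
Proof.
apply/funext => k; rewrite /pseries_diffs /expmx_coeff.
by rewrite factS natrM invfM mulrA mulVKf // exprS mulmxA.
Qed.

Lemma is_cvg_expmx_coeff (R : realType) (m : nat) (A B : 'M[R]_m) i j (x : R) :
  cvgn (pseries (expmx_coeff A B i j) x).
Proof.
apply: normed_cvg.
apply: (@series_le_cvg _ _ (fun k => `|B| * exp_coeff (m%:R * `|A| * `|x|) k)).
- by move=> k; exact: normr_ge0.
- by move=> k; rewrite mulr_ge0 // exp_coeff_ge0 // !mulr_ge0.
- move=> k; rewrite /expmx_coeff /exp_coeff /= !normrM normrX exprMn.
  rewrite normfV normr_nat [leRHS]mulrC -[leRHS]mulrA [leRHS]mulrAC.
  rewrite ler_wpM2r ?exprn_ge0 // [leRHS]mulrC -[leRHS]mulrA.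
  rewrite ler_wpM2l ?invr_ge0 //.
  exact: mulmx_exp_entry_le.
apply: (@is_cvg_seriesZ R (exp_coeff (m%:R * `|A| * `|x|))).
exact: is_cvg_series_exp_coeff.
Qed.

Lemma exprmxZ (R : realType) (m : nat) (A : 'M[R]_m) (x : R) k :
  (x *: A) ^+ k = x ^+ k *: A ^+ k.
Proof.
elim: k => [|k IHk]; first by rewrite !expr0 scale1r.
rewrite !exprS IHk -[LHS]/((x *: A) *m (x ^+ k *: A ^+ k)).
by rewrite -scalemxAl -scalemxAr scalerA.
Qed.

Lemma mulmx_series_expmx_entry (R : realType) (m : nat) (A B : 'M[R]_m)
    (x : R) i j k :
  (B *m exp_series (x *: A) k) i j
  = pseries (expmx_coeff A B i j) x k.
Proof.
rewrite /pseries /series /= mulmx_sumr summxE; apply: eq_bigr => l _.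
rewrite exprmxZ -!scalemxAr [LHS]mxE [X in _ * X]mxE /expmx_coeff.
by rewrite -mulrA [in RHS](mulrC _ (x ^+ l)).
Qed.

Lemma cvg_expmx (R : realType) (m : nat) (A : 'M[R]_m) :
  exp_series A @ \oo --> expmx A.
Proof.
apply/cvg_ex.
exists (\matrix_(i, j) limn (pseries (expmx_coeff A 1%:M i j) 1)).
apply/cvg_mxP => i j; rewrite mxE.
under eq_fun do
  rewrite -[series _ _]mul1mx -[A in X in X i j]scale1r mulmx_series_expmx_entry.
exact: is_cvg_expmx_coeff.
Qed.

Arguments cvg_expmx {R m} A.

Lemma mulmx_expmx_entry (R : realType) (m : nat) (A B : 'M[R]_m) (x : R) i j :
  (B *m expmx (x *: A)) i j = limn (pseries (expmx_coeff A B i j) x).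
Proof.
have : (fun k => B *m exp_series (x *: A) k) @ \oo
    --> B *m expmx (x *: A).
  by apply: cvg_mulmx; [exact: cvg_cst|exact: cvg_expmx].
move=> /cvg_mxP/(_ i j).
under eq_fun do rewrite mulmx_series_expmx_entry.
by move/cvg_lim => <-.
Qed.

(** The partial sums of the series are polynomials in A, so they commute with A;
    pass to the limit. *)
Lemma expmx_commute (R : realType) (m : nat) (A : 'M[R]_m) (x : R) :
  A *m expmx (x *: A) = expmx (x *: A) *m A.
Proof.
have [cvgl cvgr] :
  (fun k => A *m exp_series (x *: A) k) @ \oo
    --> A *m expmx (x *: A) /\
  (fun k => exp_series (x *: A) k *m A) @ \oo
    --> expmx (x *: A) *m A.
  by split; apply: cvg_mulmx; by [exact: cvg_cst|exact: cvg_expmx].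
apply: (@cvg_unique _ (@norm_hausdorff _ _) _ _ _ _ cvgl).
have -> // : (fun k => A *m exp_series (x *: A) k)
  = (fun k => exp_series (x *: A) k *m A).
apply/funext => k; rewrite /series /= mulmx_sumr mulmx_suml.
apply: eq_bigr => l _; rewrite -scalemxAr -scalemxAl exprmxZ -scalemxAr -scalemxAl.
by congr (_ *: (_ *: _)); rewrite -[LHS]/(A * A ^+ l) -exprS exprSr.
Qed.

(** The power series of the (i, j) entry converges everywhere, and so do its
    formal derivatives, which belong to the same family; so the series may be
    differentiated termwise at t, inside any larger disc. *)
Lemma is_derive_expmx (R : realType) (m : nat) (A : 'M[R]_m) (t : R) :
  is_derive t 1 (fun x => expmx (x *: A)) (A *m expmx (t *: A)).
Proof.
apply/is_derive_mxP => i j.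
have -> : (fun x => expmx (x *: A) i j)
    = fun x => limn (pseries (expmx_coeff A 1%:M i j) x).
  by apply/funext => x; rewrite -mulmx_expmx_entry mul1mx.
rewrite mulmx_expmx_entry.
have -> : expmx_coeff A A i j = pseries_diffs (expmx_coeff A 1%:M i j).
  by rewrite pseries_diffs_expmx_coeff mul1mx.
apply: (@pseries_snd_diffs _ _ (`|t| + 1)).
- exact: is_cvg_expmx_coeff.
- by rewrite pseries_diffs_expmx_coeff; exact: is_cvg_expmx_coeff.
- by rewrite !pseries_diffs_expmx_coeff; exact: is_cvg_expmx_coeff.
by rewrite [ltRHS]ger0_norm ?addr_ge0 // ltrDl.
Qed.

Lemma expmx0 (R : realType) (m : nat) (A : 'M[R]_m) : expmx (0 *: A) = 1%:M.
Proof.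
apply: (@cvg_lim _ (@norm_hausdorff _ _)); apply: cvg_near_cst.
exists 1%N => // -[|k] // _; rewrite /series /= big_nat_recl //=.
rewrite fact0 invr1 scale1r expr0 big1 ?addr0 // => l _.
by rewrite exprmxZ expr0n /= scale0r scaler0.
Qed.

(** The product has zero derivative because A commutes with its exponential;
    this avoids the Cauchy product of the two series. *)
Lemma expmxN_mul (R : realType) (m : nat) (A : 'M[R]_m) (t : R) :
  expmx (t *: - A) *m expmx (t *: A) = 1%:M.
Proof.
have /is_derive0_cst c0 : forall x, [set: R] x ->
    is_derive x 1 (fun y => expmx (y *: - A) *m expmx (y *: A)) 0.
  move=> x _; apply: is_derive_eq.
    exact: is_derive_mulmx (is_derive_expmx _ _) (is_derive_expmx _ _).
  by rewrite expmx_commute mulmxN mulNmx mulmxA addNr.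
rewrite (c0 _ t 0) //.
by rewrite !expmx0 mulmx1.
Qed.

(** * Lax equations and the quasi-geodesic flow *)

(** The conjugate exp(t A) L(t) exp(- t A) is constant: the commutator in L'
    cancels the terms coming from the two exponentials. *)
Lemma lax_conj (R : realType) (m : nat) (I : set R) (L : R -> 'M[R]_m)
    (A : 'M[R]_m) :
  is_interval I -> I 0 ->
  (forall t, I t -> is_derive t 1 L (L t *m A - A *m L t)) ->
  forall t, I t -> L t *m expmx (t *: - A) = expmx (t *: - A) *m L 0.
Proof.
move=> Iitv I0 dL t It.
have dC x : I x -> is_derive x 1
    (fun y => expmx (y *: A) *m L y *m expmx (y *: - A)) 0.
  move=> Ix; apply: is_derive_eq.
    apply: is_derive_mulmx (is_derive_expmx _ _).
    by apply: is_derive_mulmx; [exact: is_derive_expmx|exact: dL].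
  by rewrite (expmx_commute A) mulmxBr !mulmxA subrKC mulmxN mulNmx addrN.
have := is_derive0_cst Iitv dC It I0.
rewrite !expmx0 mul1mx mulmx1 => /(congr1 (mulmx (expmx (t *: - A)))).
by rewrite !mulmxA expmxN_mul mul1mx.
Qed.

Lemma trmx_J (R : realType) m : (J R m)^T = - J R m.
Proof.
by rewrite /J tr_block_mx !trmx0 opp_block_mx linearN /= trmx1 !oppr0 opprK.
Qed.

Lemma mulmx_JJ (R : realType) m : J R m *m J R m = - 1%:M.
Proof.
rewrite /J mulmx_block !mul0mx !mulmx0 mulmxN mulNmx !mulmx1 !addr0 !add0r.
by rewrite [in RHS]scalar_mx_block opp_block_mx !oppr0.
Qed.

Lemma derivable_is_derive1 (R : realType) (m n : nat) (F : R -> 'M[R]_(m, n)) t :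
  derivable F t 1 -> is_derive t 1 F (derive1 F t).
Proof. by move=> dF; apply: (DeriveDef dF); rewrite derive1E. Qed.

Section QuasiGeodesic.
Variables (R : realType) (p n : nat) (I : set R) (Y : R -> 'M[R]_(n + n, p + p)).
Hypotheses (I_open : open I) (I_interval : is_interval I).
Hypothesis Y_qgeo : quasi_geodesic I Y.

Let V := derive1 Y.
Let S t := (V t)^T *m J R n *m V t.
Let W t := (Y t)^T *m J R n *m V t.

Lemma is_derive_curve t : I t -> is_derive t 1 Y (V t).
Proof. by case/Y_qgeo => _ dY _ _; exact: derivable_is_derive1. Qed.

Lemma is_derive_velocity t : I t -> is_derive t 1 V (Y t *m J R p *m S t).
Proof.
case/Y_qgeo => _ _ /derivable_is_derive1 dV /subr0_eq eqV.
exact: (is_derive_eq dV eqV).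
Qed.

Lemma is_derive_form (F G : R -> 'M[R]_(n + n, p + p)) (t : R)
    (dF dG : 'M[R]_(n + n, p + p)) :
  is_derive t 1 F dF -> is_derive t 1 G dG ->
  is_derive t 1 (fun x => (F x)^T *m J R n *m G x)
    (dF^T *m J R n *m G t + (F t)^T *m J R n *m dG).
Proof.
move=> hF hG.
have hFJ : is_derive t 1 (fun x => (F x)^T *m J R n) (dF^T *m J R n).
  apply: is_derive_eq.
    exact: (is_derive_mulmx (is_derive_trmx hF) (is_derive_cst _ _ _)).
  by rewrite mulmx0 addr0.
exact: is_derive_mulmx hFJ hG.
Qed.

(** The constraint Y^T J Y = J holds on a neighbourhood of t because I is open,
    so its derivative at t vanishes. *)
Lemma velocity_tangent t : I t -> (V t)^T *m J R n *m Y t = - W t.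
Proof.
move=> It; apply/eqP; rewrite -addr_eq0; apply/eqP.
have dYY := is_derive_form (is_derive_curve It) (is_derive_curve It).
have YYJ : \near t, (Y t)^T *m J R n *m Y t = J R p.
  by apply: filterS (open_nbhs_nbhs (conj I_open It)) => x /Y_qgeo[].
have [_ <-] := near_eq_is_derive YYJ dYY.
exact: derive_cst.
Qed.

(** W' = S + Y^T J Y J S, and the constraint turns the second term into
    J J S = - S. *)
Lemma is_derive_W t : I t -> is_derive t 1 W 0.
Proof.
move=> It; apply: is_derive_eq.
  exact: is_derive_form (is_derive_curve It) (is_derive_velocity It).
have [YJY _ _ _] := Y_qgeo It.
by rewrite !mulmxA YJY mulmx_JJ !mulNmx mul1mx -!mulmxA addrN.
Qed.

(** Substituting Y'' = Y J S in S' = Y''^T J Y' + Y'^T J Y'' gives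
    S' = S J W - W J S, because S is skew and Y'^T J Y = - W. *)
Lemma is_derive_JS t : I t ->
  is_derive t 1 (fun x => J R p *m S x)
    (J R p *m S t *m (J R p *m W t) - J R p *m W t *m (J R p *m S t)).
Proof.
move=> It; apply: is_derive_eq.
  apply: (is_derive_mulmx (is_derive_cst _ _ _)).
  exact: is_derive_form (is_derive_velocity It) (is_derive_velocity It).
have trS : (S t)^T = - S t.
  by rewrite /S !trmx_mul trmxK trmx_J mulNmx mulmxN mulmxA.
rewrite mul0mx add0r trmx_mul trS trmx_mul trmx_J !mulmxA velocity_tangent //.
by rewrite mulmxN !mulNmx opprK mulmxDr mulmxN /S /W !mulmxA.
Qed.

Hypothesis I0 : I 0.

Lemma quasi_geodesicE t : I t ->
  Y t = row_mx (Y 0) (V 0)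
    *m expmx (t *: block_mx (- (J R p *m W 0)) (J R p *m S 0)
                            1%:M (- (J R p *m W 0)))
    *m col_mx 1%:M 0
    *m expmx (t *: (J R p *m W 0)).
Proof.
move=> It; set A := J R p *m W 0; set B := block_mx _ _ _ _.
have WE x : I x -> W x = W 0.
  by move=> Ix; exact: (is_derive0_cst I_interval is_derive_W Ix I0).
have JSE x : I x ->
    J R p *m S x *m expmx (x *: - A) = expmx (x *: - A) *m (J R p *m S 0).
  move=> Ix; apply: (@lax_conj _ _ I (fun y => J R p *m S y)) => // y Iy.
  by rewrite /A -(WE y Iy); exact: is_derive_JS.
(* Multiplying (Y, Y') by exp(- x A) makes its equation autonomous. *)
pose P x := row_mx (Y x *m expmx (x *: - A)) (V x *m expmx (x *: - A)).
have dP x : I x -> is_derive x 1 P (P x *m B).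
  move=> Ix; apply: is_derive_eq.
    apply: is_derive_row_mx.
      exact: is_derive_mulmx (is_derive_curve Ix) (is_derive_expmx _ _).
    exact: is_derive_mulmx (is_derive_velocity Ix) (is_derive_expmx _ _).
  rewrite mul_row_block mulmx1 !expmx_commute; congr row_mx.
    by rewrite addrC mulmxA.
  rewrite -[Y x *m _ *m _]mulmxA -[Y x *m _ *m _]mulmxA.
  by rewrite (JSE x Ix) (mulmxA (Y x)) (mulmxA (V x)).
have dPB x : I x -> is_derive x 1 (fun y => P y *m expmx (y *: - B)) 0.
  move=> Ix; apply: is_derive_eq.
    exact: is_derive_mulmx (dP x Ix) (is_derive_expmx _ _).
  by rewrite mulNmx mulmxN mulmxA addrN.
have := is_derive0_cst I_interval dPB It I0.
rewrite /P !expmx0 !mulmx1 -/(P t) => /(congr1 (mulmx^~ (expmx (t *: B)))) /=.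
rewrite -mulmxA expmxN_mul mulmx1 => <-.
by rewrite /P mul_row_col mulmx1 mulmx0 addr0 -mulmxA expmxN_mul mulmx1.
Qed.

End QuasiGeodesic.

Theorem proposition4p7 (R : realType) (p n : nat) (p_gt0 : (0 < p)%N)
    (p_le_n : (p <= n)%N) (X Z : 'M[R]_(n + n, p + p))
    (X_Sp : symplectic_stiefel X) (Z_tangent : tangent_symplectic_stiefel X Z)
    (I : set R) (I_open : open I) (I_interval : is_interval I) (I0 : I 0)
    (Y : R -> 'M[R]_(n + n, p + p)) (Y_qgeo : quasi_geodesic I Y)
    (Y0 : Y 0 = X) (dY0 : derive1 Y 0 = Z) :
  let W : 'M[R]_(p + p) := X^T *m J R n *m Z in
  forall t : R, I t ->
    Y t = row_mx X Z
      *m expmx (t *: block_mx (- (J R p *m W)) (J R p *m Z^T *m J R n *m Z)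
                              1%:M (- (J R p *m W)))
      *m col_mx 1%:M 0
      *m expmx (t *: (J R p *m W)).
Proof.
move=> W t It.
rewrite (quasi_geodesicE I_open I_interval Y_qgeo I0 It) Y0 dY0.
by rewrite -/W !mulmxA.
Qed.
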